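(* Let $s\in\mathbb{Z}\setminus\{0\}$, $t\in\mathbb{Z}_{\ge 1}$ with $\gcd(s,t)=1$. Then \[ 1<\left|e^{s/t}-\frac{M}{N}\right|Z(N)\,N^{2+2\log(|s|/\alpha)\,z(\sigma\log N)/(\sigma\log N)} \] for all $M\in\mathbb{Z}\setminus\{0\}$ and all integers $N\ge N_1$, where \[ \log N_1=\max\left\{(\eta-\beta)\log\bigl(\sigma(\eta-\beta)\bigr),\ \log\left(\frac{\gcd(2,s)}{|4s+2(s-2t)(e^{s/t}-1)|}\right)\right\}. \]
   Context: $z(y)$ denotes the inverse of the function $y(z)=z\log z$ on $z\ge 1/e$. $\mathbb{P}$ is the set of primes. Define \[ \alpha=\prod_{p\in\mathbb{P},\,p\mid s}p^{1/(p-1)},\qquad \beta=\#\{p\in\mathbb{P}\setminus\{2\}: p\mid s\},\qquad \gamma=\prod_{p\in\mathbb{P}\setminus\{2\},\,p\mid s}p, \] \[ \sigma=\frac{4t\alpha}{es^2},\qquad \zeta(N)=\frac{z(\sigma\log N)}{\sigma}+\beta, \] \[ Z(N)=\left(\frac{s^2}{\alpha^2}(\zeta(N)+1)\right)^{\beta}\left(\frac{8\gamma^2|s|(4t\zeta(N)+6t+s^2)\zeta(N)^{\beta}}{\alpha}+\frac{\gcd(2,s)\alpha^2\gamma}{N^2s^2|e^{s/t}-1|}\right), \] \[ \eta=\max\left\{\frac{\sqrt{e}\,|e^{s/t}-1|\,\gamma}{\sqrt2\,\sigma^{\beta}}-\frac12,\ \frac{e}{\sigma}+\beta\right\}. \]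 *)

(* Defs.v *)
From HB Require Import structures.
From mathcomp Require Import all_boot all_order all_algebra.
From mathcomp Require Import all_classical all_reals all_analysis.

Set Implicit Arguments.
Unset Strict Implicit.
Unset Printing Implicit Defensive.

Import Order.TTheory GRing.Theory Num.Theory.
Import numFieldNormedType.Exports.

Local Open Scope classical_set_scope.
Local Open Scope ring_scope.

(* z |-> z log z is injective on [1/e, +oo[, so this partial inverse is the inverse
   there; its values below -1/e, the minimum of z log z, are junk. *)
Definition zinv (R : realType) : R -> R :=
  pinv [set z : R | (expR 1)^-1 <= z] (fun z : R => z * ln z).

Definition alpha (R : realType) (s : int) : R :=
  \prod_(p <- primes `|s|%N) (p%:R `^ (p%:R - 1)^-1).

Definition beta (s : int) : nat := count (fun p => p != 2%N) (primes `|s|%N).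

Definition gam (s : int) : nat :=
  (\prod_(p <- primes `|s|%N | p != 2) p)%N.

Definition sigma (R : realType) (s t : int) : R :=
  4 * t%:~R * alpha R s / (expR 1 * s%:~R ^+ 2).

Definition zeta (R : realType) (s t N : int) : R :=
  zinv (sigma R s t * ln N%:~R) / sigma R s t + (beta s)%:R.

Definition Zfun (R : realType) (s t N : int) : R :=
  (s%:~R ^+ 2 / alpha R s ^+ 2 * (zeta R s t N + 1)) ^+ beta s *
  (8 * (gam s)%:R ^+ 2 * `|s%:~R| *
     (4 * t%:~R * zeta R s t N + 6 * t%:~R + s%:~R ^+ 2) *
     zeta R s t N ^+ beta s / alpha R s
   + (gcdz 2 s)%:~R * alpha R s ^+ 2 * (gam s)%:R /
     (N%:~R ^+ 2 * s%:~R ^+ 2 * `|expR (s%:~R / t%:~R) - 1|)).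

Definition eta (R : realType) (s t : int) : R :=
  Num.max
    (Num.sqrt (expR 1) * `|expR (s%:~R / t%:~R) - 1| * (gam s)%:R /
       (Num.sqrt 2 * sigma R s t ^+ beta s) - 2^-1)
    (expR 1 / sigma R s t + (beta s)%:R).

Definition logN1 (R : realType) (s t : int) : R :=
  Num.max
    ((eta R s t - (beta s)%:R) * ln (sigma R s t * (eta R s t - (beta s)%:R)))
    (ln ((gcdz 2 s)%:~R /
         `|4 * s%:~R
           + 2 * (s%:~R - 2 * t%:~R) * (expR (s%:~R / t%:~R) - 1)|)).

Definition N1 (R : realType) (s t : int) : R := expR (logN1 R s t).

(* Main.v *)
Require Import Defs.
From HB Require Import structures.
From mathcomp Require Import all_boot all_order all_algebra.
From mathcomp Require Import all_classical all_reals all_analysis.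
From mathcomp Require Import unstable zify ring lra.

Set Implicit Arguments.
Unset Strict Implicit.
Unset Printing Implicit Defensive.

Import Order.TTheory GRing.Theory Num.Theory.
Import numFieldNormedType.Exports.

Local Open Scope ring_scope.

(** The diagonal Padé forms [rho_n = q_n e^(s/t) - p_n] of the exponential have
integer coefficients satisfying [f_(n+2) = (4n+6) t f_(n+1) + s^2 f_n], and
[p_n], [q_n] share a divisor [D_n] of size about [alpha^n] coming from the
primes dividing [s]. Let [m] be the last index with [2 N |rho_m| >= D_m]. The upper
bound [|rho_m| <= s^(2m) m! |e^(s/t) - 1| / (t^m (2m+1)!)] forces
[m <= zeta(N)]. Since consecutive forms have opposite signs, the determinant
[q_(m+1) p_m - q_m p_(m+1) = +-2 s^(2m+1)] and the lower bound on [|rho_m|]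
bound [q_(m+1)], hence [q_(m+2)], from above. One of the two
indices [k = m+1, m+2] has [q_k M - p_k N <> 0]; this is a multiple of [D_k], so
[D_k <= N |q_k| |e^(s/t) - M/N| + N |rho_k|] with the last term below [D_k / 2]. *)

(** * Padé polynomials of the exponential *)

(* Equals (2n-k)! / (k! (n-k)!) for k <= n and 0 for k > n; the first factor is
   what makes the truncated subtractions harmless for k > n. *)
Definition padec (n k : nat) : nat :=
  ('C(n.*2 - k, k) * (n - k).*2 ^_ (n - k))%N.

(** Homogeneous of degree [n] in [s] and [t]: p_n is [pade s t n] and q_n is [pade (- s) t n]. *)
Definition pade (K : comNzRingType) (s t : K) (n : nat) : K :=
  \sum_(k < n.+1) (padec n k)%:R * s ^+ k * t ^+ (n - k).

Lemma padecDE k d : (padec (k + d) k = 'C(k + d.*2, k) * d.*2 ^_ d)%N.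
Proof. by rewrite /padec; congr ('C(_, _) * _ ^_ _)%N; lia. Qed.

(** Writing n = k + d removes every truncated subtraction; the recurrences below reduce to this
    product form. *)
Lemma padec_fact k d :
  (padec (k + d) k * (k`! * d`!) = (k + d.*2)`!)%N.
Proof.
have h1 : (d.*2 ^_ d * d`! = d.*2`!)%N.
  by rewrite -[in d`!](addnK d d) addnn ffact_fact// -addnn leq_addr.
by rewrite -(bin_fact (leq_addr d.*2 k)) addKn -h1 padecDE; ring.
Qed.

Lemma padec_small n k : (n < k)%N -> padec n k = 0%N.
Proof. by move=> nk; rewrite /padec bin_small//; lia. Qed.

Lemma padec_diag n : padec n n = 1%N.
Proof. by rewrite /padec -addnn addnK binn subnn ffactn0. Qed.

Lemma padec_rec0 n : padec n.+2 0 = ((4 * n + 6) * padec n.+1 0)%N.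
Proof.
have := padec_fact 0 n.+2; have := padec_fact 0 n.+1.
rewrite !add0n fact0 !mul1n.
rewrite !doubleS => h1 h2.
apply/eqP; rewrite -(eqn_pmul2r (fact_gt0 n.+2)) h2 [(n.*2.+4)`!]factS [(n.*2.+3)`!]factS -h1.
by rewrite [(n.+2)`!]factS; apply/eqP; rewrite -!muln2; ring.
Qed.

Lemma padec_rec1 n : padec n.+2 1 = ((4 * n + 6) * padec n.+1 1)%N.
Proof.
have := padec_fact 1 n.+1; have := padec_fact 1 n.
rewrite !add1n (_ : 1`! = 1)%N// !mul1n doubleS => h1 h2.
apply/eqP; rewrite -(eqn_pmul2r (fact_gt0 n.+1)) h2.
rewrite [(n.*2.+3)`!]factS [(n.*2.+2)`!]factS -h1.
by rewrite [(n.+1)`!]factS; apply/eqP; rewrite -!muln2; ring.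
Qed.

Lemma padec_rec n k :
  padec n.+2 k.+2 = ((4 * n + 6) * padec n.+1 k.+2 + padec n k)%N.
Proof.
have [nk|kn] := ltnP n k; first by rewrite !padec_small//; lia.
have [d ->] : exists d, n = (k + d)%N by exists (n - k)%N; lia.
case: d => [|d].
  by rewrite addn0 !padec_diag padec_small// muln0.
have := padec_fact k.+2 d.+1; have := padec_fact k d.+1; have := padec_fact k.+2 d.
have -> : ((k + d.+1).+2 = k.+2 + d.+1)%N by lia.
have -> : ((k + d.+1).+1 = k.+2 + d)%N by lia.
have -> : ((k.+2 + d.+1.*2) = (k + d.*2).+4)%N by lia.
have -> : ((k.+2 + d.*2) = (k + d.*2).+2)%N by lia.
have -> : ((k + d.+1.*2) = (k + d.*2).+2)%N by lia.
rewrite [(_.+4)`!]factS [(_.+3)`!]factS => h1 h2 h3.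
apply/eqP; rewrite -(eqn_pmul2r (fact_gt0 k.+2)) -(eqn_pmul2r (fact_gt0 d.+1)).
apply/eqP; rewrite -mulnA h3.
(* Both parenthesised products equal (k+2d+2)!, which leaves (k+2d+4)(k+2d+3) = (4(k+d+1)+6)(d+1) +
   (k+2)(k+1). *)
transitivity ((4 * (k + d.+1) + 6) * d.+1 * (padec (k.+2 + d) k.+2 * ((k.+2)`! * d`!)) +
  k.+2 * k.+1 * (padec (k + d.+1) k * (k`! * d.+1`!)))%N.
  by rewrite h1 h2; rewrite -!muln2; ring.
by rewrite [k.+2`!]factS [k.+1`!]factS [d.+1`!]factS; ring.
Qed.

Lemma pade_wide (K : comNzRingType) (s t : K) n m : (n < m)%N ->
  pade s t n = \sum_(k < m) (padec n k)%:R * s ^+ k * t ^+ (n - k).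
Proof.
move=> nm; rewrite /pade.
rewrite [RHS](bigID (fun k : 'I_m => (k < n.+1)%N))/= [X in _ = _ + X]big1 ?addr0; last first.
  by move=> i; rewrite -leqNgt => ?; rewrite padec_small// !mul0r.
by rewrite (big_ord_widen _ (fun k => (padec n k)%:R * s ^+ k * t ^+ (n - k)) nm).
Qed.

(** Coefficients are compared in s: degrees 0 and 1 receive nothing from the s^2 term, and all
    others follow [padec_rec]. *)
Lemma pade_rec (K : comNzRingType) (s t : K) n :
  pade s t n.+2 = (4 * n + 6)%:R * t * pade s t n.+1 + s ^+ 2 * pade s t n.
Proof.
rewrite (@pade_wide _ _ _ n.+1 n.+3)// /pade.
rewrite !(big_ord_recl n.+2) !(big_ord_recl n.+1).
rewrite !mulrDr addrA -!addrA; congr (_ + (_ + _)).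
- by rewrite padec_rec0 !subn0 !expr0 natrM exprS; ring.
- by rewrite /bump/= padec_rec1 !subSS !subn0 natrM exprS; ring.
rewrite !mulr_sumr -big_split/=; apply: eq_bigr => i _.
rewrite /bump/= !add1n !subSS padec_rec natrD natrM.
(* In top degree the exponent of t in the middle term truncates to 0, but the coefficient there
   vanishes. *)
have := ltn_ord i; rewrite ltnS leq_eqVlt => /orP[/eqP ->|ilt].
  by rewrite [padec n.+1 n.+2]padec_small// subnn !exprS; ring.
have -> : (n - i = (n - i.+1).+1)%N by lia.
by rewrite !exprS; ring.
Qed.

Lemma pade0 (K : comNzRingType) (s t : K) : pade s t 0 = 1.
Proof. by rewrite /pade big_ord1 padec_diag !expr0 !mulr1. Qed.

Lemma pade1 (K : comNzRingType) (s t : K) : pade s t 1 = 2 * t + s.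
Proof.
rewrite /pade !big_ord_recl big_ord0 padec_diag /= /padec/=.
rewrite !expr0 bin0 /bump/= !subn0 !expr1 addr0 !mulr1 mul1r mul1n.
by rewrite (_ : 1.*2 = 2)%N// ffactn1.
Qed.

Lemma pade_rmorph (K L : comNzRingType) (f : {rmorphism K -> L}) (s t : K) n :
  f (pade s t n) = pade (f s) (f t) n.
Proof.
rewrite /pade rmorph_sum; apply: eq_bigr => i _.
by rewrite !(rmorphM f) rmorph_nat !(rmorphXn f).
Qed.

(** * The common divisor D_n *)

(* At odd p the exponent comes from the factor n!/k! of the coefficient
   C(2n-k,n) n!/k!; at p = 2 the coefficient of s^k is divisible by 2^(n-k). *)
Definition padeden_exp (n p : nat) : nat := if p == 2 then n else logn p n`!.

Definition padeden (s : int) (n : nat) : nat :=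
  \prod_(p <- primes `|s|%N) p ^ padeden_exp n p.

(** Legendre's formula as a recursion: only p, 2p, ... contribute to the valuation, and dividing
    each of them by p leaves (m/p)!. The next two bounds are strong inductions along it. *)
Lemma logn_fact_rec p m : prime p ->
  logn p m`! = (m %/ p + logn p (m %/ p)`!)%N.
Proof.
move=> pp; case: m => [|m]; first by rewrite div0n fact0 logn1.
rewrite !logn_fact// big_ltn// expn1; congr addn.
have mp : (m.+1 %/ p < m.+1)%N by rewrite ltn_Pdiv// prime_gt1.
rewrite big_add1 /= (eq_bigr (fun i => m.+1 %/ p %/ p ^ i)%N); last first.
  by move=> i _; rewrite expnS divnMA.
rewrite [RHS](big_nat_widen _ _ m.+1) // [LHS](bigID (fun i => i < (m.+1 %/ p).+1))%N/=.
rewrite [X in (_ + X)%N]big1 ?addn0// => i; rewrite -leqNgt => hi.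
by rewrite divn_small// (leq_trans hi)// ltnW// ltn_expl// prime_gt1.
Qed.

Lemma logn_fact_le p m : prime p -> (logn p m`! <= m)%N.
Proof.
move=> pp; have [n] := ubnP m; elim: n m => // n IH [|m]; first by rewrite fact0 logn1.
rewrite ltnS => mn.
have h : (m.+1 %/ p < m.+1)%N by rewrite ltn_Pdiv// prime_gt1.
rewrite logn_fact_rec//; have := IH _ (leq_trans h mn).
have := leq_trunc_div m.+1 p; have := prime_gt1 pp; nia.
Qed.

(** The valuation of m! is (m - digit sum of m in base p) / (p-1), and m has [(trunc_log p m).+1]
    digits, each at most p-1. The induction strips one digit at a time. *)
Lemma expn_fact_le p m : prime p -> (0 < m)%N ->
  (m <= p.-1 * (logn p m`! + (trunc_log p m).+1))%N.
Proof.
move=> pp; have p1 := prime_gt1 pp.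
have [n] := ubnP m; elim: n m => // n IH m mn m0.
have [mp|pm] := ltnP m p; first by nia.
have h : (m %/ p < m)%N by rewrite ltn_Pdiv.
have h0 : (0 < m %/ p)%N by rewrite divn_gt0 // ltnW.
rewrite logn_fact_rec// (_ : trunc_log p m = (trunc_log p (m %/ p)).+1); last first.
  apply: trunc_log_eq => //; rewrite !expnS -[X in (X <= _)%N]mulnC -leq_divRL ?(ltnW p1)//.
  rewrite trunc_logP//= mulnC -ltn_divLR ?(ltnW p1)//.
  by rewrite -expnS trunc_log_ltn.
have := IH _ (leq_trans h mn) h0.
by have := divn_eq m p; have := ltn_pmod m (ltnW p1); nia.
Qed.

Lemma dvdn_prod_primes (l : seq nat) (e : nat -> nat) m :
  uniq l -> all prime l -> (forall p, p \in l -> p ^ e p %| m)%N ->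
  (\prod_(p <- l) p ^ e p %| m)%N.
Proof.
elim: l => [|p l IH]/=; first by rewrite big_nil dvd1n.
move=> /andP[pl ul] /andP[pp al] h; rewrite big_cons Gauss_dvd; last first.
  apply: (@coprime_prodr _ l xpredT (fun q => q ^ e q)%N p l).
  rewrite all_map filter_predT.
  apply/allP => q ql /=; apply: coprimeXl; apply: coprimeXr.
  rewrite prime_coprime// dvdn_prime2//; last exact: (allP al).
  by apply: contra pl => /eqP ->.
by rewrite h ?inE ?eqxx//= IH// => q ql; apply: h; rewrite inE ql orbT.
Qed.

(** The quotient (2d)!/d! is 2^d times the product of the first d odd numbers. *)
Lemma dvdn_fact_double d : (2 ^ d %| d.*2 ^_ d)%N.
Proof.
rewrite -(@dvdn_pmul2r d`!) ?fact_gt0// -[in d`!](addnK d d) addnn ffact_fact; last first.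
  by rewrite -addnn leq_addr.
rewrite -addnn addnK.
elim: d => // d IH.
rewrite addSn addnS [d.+1`!]factS expnS [(d + d).+2`!]factS [(d + d).+1`!]factS.
rewrite [X in (_ %| X)%N](_ : _ = (2 * d.+1 * (d + d).+1) * (d + d)`!)%N; last first.
  by rewrite addnn -muln2; ring.
rewrite [X in (X %| _)%N](_ : _ = (2 * d.+1) * (2 ^ d * d`!))%N; last by ring.
by apply: dvdn_mul => //; rewrite dvdn_mulr.
Qed.

(** For p = 2, s^k supplies 2^k and the coefficient 2^(n-k). For odd p, [padec n k * k!] is a
    multiple of n!, and the valuation of k!, at most k, is made up by s^k. *)
Lemma padeden_dvd_term (s : int) n k : s != 0 -> (k <= n)%N ->
  (padeden s n %| padec n k * `|s| ^ k)%N.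
Proof.
move=> s0 kn; apply: dvdn_prod_primes; [exact: primes_uniq|exact: all_prime_primes|].
move=> p; rewrite mem_primes => /and3P[pp _ ps].
have [d ->] : exists d, n = (k + d)%N by exists (n - k)%N; lia.
rewrite /padeden_exp; case: eqP => [p2|_].
  rewrite p2 expnD [(2 ^ k * _)%N]mulnC dvdn_mul//; last by rewrite p2 in ps; apply: dvdn_exp2r.
  by rewrite padecDE dvdn_mull// dvdn_fact_double.
have h : (padec (k + d) k * k`! = 'C(k + d.*2, d) * (k + d)`!)%N.
  apply/eqP; rewrite -(eqn_pmul2r (fact_gt0 d)) -mulnA padec_fact.
  rewrite -mulnA [((k + d)`! * _)%N]mulnC -(@bin_fact (k + d.*2) d); last by lia.
  by rewrite (_ : (k + d.*2 - d = k + d)%N)//; lia.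
rewrite pfactor_dvdn //; last first.
  rewrite muln_gt0 expn_gt0 absz_gt0 s0 orTb andbT.
  have : (0 < (k + d.*2)`!)%N by rewrite fact_gt0.
  by rewrite -padec_fact; case: (padec _ _).
have c0 : (0 < padec (k + d) k)%N.
  have : (0 < (k + d.*2)`!)%N by rewrite fact_gt0.
  by rewrite -padec_fact; case: (padec _ _).
have b0 : (0 < 'C(k + d.*2, d))%N by rewrite bin_gt0; lia.
have s1 : (0 < `|s| ^ k)%N by rewrite expn_gt0 absz_gt0 s0.
rewrite (lognM _ c0 s1) lognX.
have := congr1 (logn p) h; rewrite (lognM _ c0 (fact_gt0 k)) (lognM _ b0 (fact_gt0 _)).
have : (0 < logn p `|s|)%N by rewrite logn_gt0 mem_primes pp absz_gt0 s0.
have := logn_fact_le k pp; nia.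
Qed.

Lemma padeden_dvd (s t : int) n : s != 0 ->
  exists Q : int, pade s t n = (padeden s n)%:Z * Q.
Proof.
move=> s0; have : (padeden s n %| pade s t n)%Z.
  rewrite /pade; apply: rpred_sum => k _; apply: dvdz_mulr.
  rewrite dvdzE abszM abszX /= natz absz_nat.
  have := ltn_ord k; move: (nat_of_ord k) => j; rewrite ltnS; exact: padeden_dvd_term.
by move=> /dvdzP[Q ->]; exists Q; rewrite mulrC.
Qed.

Lemma padedenN (s : int) n : padeden (- s) n = padeden s n.
Proof. by rewrite /padeden abszN. Qed.

Lemma padeden_gt0 (s : int) n : (0 < padeden s n)%N.
Proof.
rewrite /padeden big_seq; elim/big_ind: _ => // [a b|p].
  by rewrite muln_gt0 => -> ->.
by rewrite mem_primes => /and3P[pp _ _]; rewrite expn_gt0 prime_gt0.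
Qed.

Lemma padeden_le (s : int) n : (padeden s n <= padeden s n.+1)%N.
Proof.
rewrite /padeden big_seq [leqRHS]big_seq; apply: leq_prod => p.
rewrite mem_primes => /and3P[pp _ _].
rewrite leq_exp2l ?prime_gt1// /padeden_exp; case: ifP => // _.
by rewrite dvdn_leq_log// ?fact_gt0// factS dvdn_mull.
Qed.

(** This is the source of gcd(2,s) in [logN1]: the odd primes contribute nothing to D_1. *)
Lemma padeden1 (s : int) : s != 0 -> (padeden s 1)%:Z = gcdz 2 s.
Proof.
move=> s0; rewrite /gcdz; congr Posz; rewrite /padeden /padeden_exp.
rewrite (eq_bigr (fun p => if p == 2 then 2 else 1)%N); last first.
  by move=> p _; case: eqP => [->//|_]; rewrite logn1.
rewrite -big_mkcond big_const_seq iter_muln muln1 count_uniq_mem ?primes_uniq//.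
rewrite mem_primes absz_gt0 s0 /=.
have [h|h] := boolP (2 %| `|s|)%N; first by rewrite expn1 (gcdn_idPl h).
by apply/esym/eqP; rewrite expn0; move: h; rewrite -prime_coprime.
Qed.

(** * Remainder of the Padé approximation *)

Section Remainder.
Local Open Scope classical_set_scope.
Local Open Scope ring_scope.
Context {R : realType}.
Implicit Types x s t : R.

Definition pade_rem x n : R := pade (- x) 1 n * expR x - pade x 1 n.

(* Terms of the power series of (-1)^n pade_rem x n, all positive for x > 0. *)
Definition rem_term x (n j : nat) : R :=
  (n + j)`!%:R / (j`!%:R * (n.*2 + j).+1`!%:R) * x ^+ (n.*2 + j).+1.

Lemma pade_rem_rec x n :
  pade_rem x n.+2 = (4 * n + 6)%:R * pade_rem x n.+1 + x ^+ 2 * pade_rem x n.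
Proof. by rewrite /pade_rem !pade_rec; ring. Qed.

Lemma pade_rem0 x : pade_rem x 0 = expR x - 1.
Proof. by rewrite /pade_rem !pade0 mul1r. Qed.

Lemma pade_rem1 x : pade_rem x 1 = (2 - x) * expR x - (2 + x).
Proof. by rewrite /pade_rem !pade1 !mulr1. Qed.

Let fact_neq0 n : n`!%:R != 0 :> R.
Proof. by rewrite pnatr_eq0 -lt0n fact_gt0. Qed.

(** Terms with the same power of x are matched, whence the shift by two in j; the sign differs from
    [pade_rem_rec] because of the factor (-1)^n. *)
Lemma rem_term_rec x n j :
  rem_term x n.+2 j =
  x ^+ 2 * rem_term x n j.+2 - (4 * n + 6)%:R * rem_term x n.+1 j.+2.
Proof.
rewrite /rem_term !doubleS !addSn !addnS.
rewrite [(n + j).+3`!]factS [j.+2`!]factS [j.+1`!]factS.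
rewrite [(n.*2 + j).+4.+1`!]factS [(n.*2 + j).+4`!]factS.
move: (fact_neq0 j) (fact_neq0 (n.*2 + j).+3).
move: (n + j).+2`! j`! (n.*2 + j).+3`! => a b c b0 c0.
rewrite !natrM !exprS -muln2; field.
have := ler0n R n; have := ler0n R j => j0 n0.
by rewrite b0 c0 /=; repeat (apply/andP; split); apply: lt0r_neq0; lra.
Qed.

Let fact1 : 1`! = 1%N. Proof. by []. Qed.

(** The two lowest terms cancel, so the order of vanishing at 0 grows by two with each n. *)
Lemma rem_term_rec01 x n j : (j < 2)%N ->
  x ^+ 2 * rem_term x n j = (4 * n + 6)%:R * rem_term x n.+1 j.
Proof.
have n0 := ler0n R n; rewrite /rem_term !doubleS; case: j => [|[|//]] _.
  rewrite fact0 !addn0 [n.+1`!]factS [(n.*2).+3`!]factS [(n.*2).+2`!]factS.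
  move: (fact_neq0 n.*2.+1); move: n`! (n.*2).+1`! => a b b0.
  rewrite !natrM !exprS -muln2; field.
  by rewrite b0 /=; repeat (apply/andP; split); apply: lt0r_neq0; lra.
rewrite !addn1 fact1 [n.+2`!]factS [(n.*2).+4`!]factS [(n.*2).+3`!]factS.
move: (fact_neq0 n.*2.+2); move: n.+1`! (n.*2).+2`! => a b b0.
rewrite !natrM !exprS -muln2; field.
by rewrite b0 /=; repeat (apply/andP; split); apply: lt0r_neq0; lra.
Qed.

Lemma series_rem_term_rec x n J :
  series (rem_term x n.+2) J = x ^+ 2 * series (rem_term x n) J.+2 -
    (4 * n + 6)%:R * series (rem_term x n.+1) J.+2.
Proof.
elim: J => [|J IH].
  rewrite !seriesSr {1}/series /= /series /= !big_geq// !add0r.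
  by rewrite !mulrDr !rem_term_rec01//; ring.
by rewrite seriesSr IH rem_term_rec !(seriesSr _ J.+2); ring.
Qed.

Lemma series_exp_coeff_cvg x : series (exp_coeff x) @ \oo --> expR x.
Proof. exact: is_cvg_series_exp_coeff. Qed.

Lemma series_rem_term0 x J :
  series (rem_term x 0) J = series (exp_coeff x) J.+1 - 1.
Proof.
elim: J => [|J IH].
  by rewrite seriesSr /series/= !big_geq// /exp_coeff/= fact0 expr0; field.
rewrite seriesSr IH [in RHS]seriesSr /rem_term /exp_coeff /= !add0n; field.
by rewrite !fact_neq0.
Qed.

Lemma series_rem_term1 x J : series (rem_term x 1) J =
  x * series (exp_coeff x) J.+2 - 2 * series (exp_coeff x) J.+3 + x + 2.
Proof.
elim: J => [|J IH].
  rewrite !seriesSr /series/= !big_geq// /exp_coeff/= fact0 fact1 (_ : 2`! = 2)%N//.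
  by rewrite expr0 expr1; field.
rewrite seriesSr IH (seriesSr _ J.+3) (seriesSr _ J.+2) /rem_term /exp_coeff /=.
have J0 := ler0n R J.
rewrite (_ : 1.*2 = 2)%N// add1n add2n [J.+3`!]factS [J.+2`!]factS [J.+1`!]factS.
move: (fact_neq0 J); move: J`! => a a0; rewrite !natrM !exprS; field.
by rewrite a0 /=; repeat (apply/andP; split); apply: lt0r_neq0; lra.
Qed.

(** No integral representation is used: n = 0 and n = 1 come from the exponential series, and the
    recurrence passes to the limit, so the induction carries two consecutive indices. *)
Lemma rem_term_cvg x n : series (rem_term x n) @ \oo --> (-1) ^+ n * pade_rem x n.
Proof.
suff : series (rem_term x n) @ \oo --> (-1) ^+ n * pade_rem x n /\
  series (rem_term x n.+1) @ \oo --> (-1) ^+ n.+1 * pade_rem x n.+1 by case.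
have ec := @series_exp_coeff_cvg x.
elim: n => [|n [IH1 IH2]]; split => //.
- rewrite (_ : series _ = fun J => series (exp_coeff x) J.+1 - 1).
    rewrite mul1r pade_rem0; apply: cvgB; last exact: cvg_cst.
    by rewrite (cvg_shiftS (series (exp_coeff x))).
  by apply/funext => J; rewrite series_rem_term0.
- rewrite (_ : series _ = fun J => x * series (exp_coeff x) J.+2 - 2 * series (exp_coeff x) J.+3 + x + 2).
    rewrite (_ : _ * _ = x * expR x - 2 * expR x + x + 2); last by rewrite pade_rem1; ring.
    apply: cvgD; last exact: cvg_cst.
    apply: cvgD; last exact: cvg_cst.
    by apply: cvgB; apply: cvgMr; rewrite ?(cvg_shiftS (fun J => series (exp_coeff x) J.+2))
     ?(cvg_shiftS (fun J => series (exp_coeff x) J.+1)) ?(cvg_shiftS (series (exp_coeff x))).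
  by apply/funext => J; rewrite series_rem_term1.
- rewrite (_ : series _ = fun J => x ^+ 2 * series (rem_term x n) J.+2 -
    (4 * n + 6)%:R * series (rem_term x n.+1) J.+2).
    rewrite (_ : _ * _ = x ^+ 2 * ((-1) ^+ n * pade_rem x n) -
     (4 * n + 6)%:R * ((-1) ^+ n.+1 * pade_rem x n.+1)); last first.
      by rewrite pade_rem_rec !exprS; ring.
    by apply: cvgB; apply: cvgMr; rewrite ?(cvg_shiftS (fun J => series _ J.+1)) (cvg_shiftS (series _)).
  by apply/funext => J; rewrite series_rem_term_rec.
Qed.

Lemma rem_term_gt0 x n j : 0 < x -> 0 < rem_term x n j.
Proof.
move=> x0; rewrite /rem_term; apply: mulr_gt0; last exact: exprn_gt0.
by rewrite divr_gt0// ?mulr_gt0// ltr0n fact_gt0.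
Qed.

(** Compares the coefficients of [rem_term] with 1/(j+1)!. The induction step needs (n+j+1)(j+2) <=
    (2n+j+2)(j+1), whose sides differ by nj. *)
Lemma fact_ratio_le n j :
  ((n + j)`! * j.+1 * (n.*2).+1`! <= n`! * (n.*2 + j).+1`!)%N.
Proof.
elim: j => [|j IH]; first by rewrite !addn0 muln1.
rewrite !addnS [(n + j).+1`!]factS [(n.*2 + j).+2`!]factS.
apply: (@leq_trans ((n.*2 + j).+2 * ((n + j)`! * j.+1 * (n.*2).+1`!))).
  rewrite [X in (X <= _)%N](_ : _ = (n + j).+1 * j.+2 * ((n + j)`! * (n.*2).+1`!))%N; last by ring.
  rewrite [X in (_ <= X)%N](_ : _ = (n.*2 + j).+2 * j.+1 * ((n + j)`! * (n.*2).+1`!))%N; last by ring.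
  by apply: leq_mul => //; nia.
by rewrite [X in (_ <= X)%N]mulnCA leq_mul.
Qed.

Lemma rem_term_le x n j : 0 < x -> rem_term x n j <=
  x ^+ n.*2 * n`!%:R / (n.*2).+1`!%:R * exp_coeff x j.+1.
Proof.
move=> x0; rewrite /rem_term /exp_coeff /=.
rewrite -addnS exprD [leLHS]mulrCA [leRHS](_ : _ = x ^+ n.*2 *
  (n`!%:R / (n.*2.+1`!%:R * j.+1`!%:R) * x ^+ j.+1)); last first.
  by field; rewrite !fact_neq0.
rewrite ler_pM2l ?exprn_gt0// ler_pM2r ?exprn_gt0//.
have fp m : 0 < m`!%:R :> R by rewrite ltr0n fact_gt0.
rewrite ler_pdivrMr ?mulr_gt0// mulrAC ler_pdivlMr ?mulr_gt0//.
rewrite -!natrM ler_nat [j.+1`!]factS addnS.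
rewrite [X in (X <= _)%N](_ : _ = j`! * ((n + j)`! * j.+1 * (n.*2).+1`!))%N; last by ring.
by rewrite [X in (_ <= X)%N]mulnCA; apply: leq_mul => //; exact: fact_ratio_le.
Qed.

Lemma pade_rem_gt0 x n : 0 < x -> 0 < (-1) ^+ n * pade_rem x n.
Proof.
move=> x0; apply: (lt_le_trans (rem_term_gt0 n 0 x0)).
have /(ler_cvg_to (cvg_cst (rem_term x n 0))) := rem_term_cvg (x := x) (n := n).
apply; near=> J.
have -> : J = J.-1.+1 by rewrite prednK//; near: J; exact: nbhs_infty_gt.
rewrite /series/= big_nat_recl//= lerDl; apply: sumr_ge0 => i _; exact/ltW/rem_term_gt0.
Unshelve. all: by end_near. Qed.

(** Termwise comparison with the series of e^x - 1; dropping its constant term shifts the partial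
    sums by one. *)
Lemma pade_rem_le x n : 0 < x -> (-1) ^+ n * pade_rem x n <=
  x ^+ n.*2 * n`!%:R / (n.*2).+1`!%:R * (expR x - 1).
Proof.
move=> x0; set c := _ / _.
have h : (fun J => c * (series (exp_coeff x) J.+1 - 1)) @ \oo --> c * (expR x - 1).
  apply: cvgMr; apply: cvgB; last exact: cvg_cst.
  by rewrite (cvg_shiftS (series (exp_coeff x))); exact: series_exp_coeff_cvg.
apply: (ler_cvg_to (rem_term_cvg (x := x) (n := n)) h).
apply: nearW => J; elim: J => [|J IH].
  by rewrite seriesSr /series/= !big_geq// /exp_coeff/= expr0 divr1 add0r subrr mulr0.
rewrite seriesSr (seriesSr _ J.+1) addrAC mulrDr lerD//; exact: rem_term_le.
Qed.

End Remainder.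

(** * Padé forms at s/t: signs, size and determinant *)

Section Forms.
Context {R : realType}.
Implicit Types x s t : R.

Definition pade_form s t n : R := pade (- s) t n * expR (s / t) - pade s t n.

Lemma pade_homog s t n : t != 0 -> pade s t n = t ^+ n * pade (s / t) 1 n.
Proof.
move=> t0; rewrite /pade mulr_sumr; apply: eq_bigr => k _.
have kn : (k <= n)%N by rewrite -ltnS.
have -> : t ^+ n = t ^+ (n - k) * t ^+ k by rewrite -exprD subnK.
rewrite expr1n mulr1 expr_div_n; field.
by rewrite expf_neq0.
Qed.

Lemma pade_formE s t n : t != 0 -> pade_form s t n = t ^+ n * pade_rem (s / t) n.
Proof.
move=> t0; rewrite /pade_form /pade_rem (pade_homog s _ t0) (pade_homog (- s) _ t0).
by rewrite mulNr; ring.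
Qed.

(** Changing the sign of x swaps p_n and q_n; this reduces negative arguments to positive ones. *)
Lemma pade_remN x n : pade_rem (- x) n = - expR (- x) * pade_rem x n.
Proof.
by rewrite /pade_rem opprK expRN; field; rewrite expR_eq0.
Qed.

(** For x > 0 the sign of the remainder is (-1)^n; for x < 0 two consecutive remainders pick up the
    same factor, so the product keeps its sign. *)
Lemma pade_rem_alt x n : x != 0 -> pade_rem x n * pade_rem x n.+1 < 0.
Proof.
have pos (y : R) : 0 < y -> pade_rem y n * pade_rem y n.+1 < 0.
  move=> y0; have := mulr_gt0 (pade_rem_gt0 n y0) (pade_rem_gt0 n.+1 y0).
  rewrite -oppr_gt0 [X in 0 < X -> _](_ : _ = - (pade_rem y n * pade_rem y n.+1))//.
  by rewrite mulrACA -exprD addnS -signr_odd /= addnn odd_double expr1 mulN1r.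
rewrite neq_lt => /orP[x0|/pos//].
have remN m : pade_rem x m = - expR x * pade_rem (- x) m.
  by have := pade_remN (- x) m; rewrite opprK.
rewrite !remN.
rewrite [ltLHS](_ : _ = expR x ^+ 2 * (pade_rem (- x) n * pade_rem (- x) n.+1)); last by ring.
by rewrite pmulr_rlt0 ?pos ?oppr_gt0// exprn_gt0// expR_gt0.
Qed.

Lemma norm_pade_rem_le x n : x != 0 ->
  `|pade_rem x n| <= x ^+ n.*2 * n`!%:R / (n.*2).+1`!%:R * `|expR x - 1|.
Proof.
have pos (y : R) : 0 < y -> `|pade_rem y n| <=
    y ^+ n.*2 * n`!%:R / (n.*2).+1`!%:R * `|expR y - 1|.
  move=> y0; have -> : `|pade_rem y n| = `|(-1) ^+ n * pade_rem y n|.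
    by rewrite normrM normrX normrN1 expr1n mul1r.
  rewrite gtr0_norm ?pade_rem_gt0// [`|expR y - 1|]ger0_norm ?pade_rem_le//.
  by rewrite subr_ge0 ltW// expR_gt1.
rewrite neq_lt => /orP[x0|/pos//].
have := pade_remN (- x) n; rewrite opprK => ->; rewrite normrM normrN (ger0_norm (expR_ge0 _)).
rewrite -oppr_gt0 in x0; have := pos _ x0.
rewrite -(ler_pM2l (expR_gt0 x)) => /le_trans; apply.
have -> : x ^+ n.*2 = (- x) ^+ n.*2 by rewrite -mul2n !exprM sqrrN.
rewrite mulrCA; apply: ler_wpM2l.
  by rewrite divr_ge0// mulr_ge0// exprn_ge0// ltW.
by rewrite -[X in X * _](ger0_norm (expR_ge0 x)) -normrM mulrBr -expRD subrr expR0 mulr1 distrC.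
Qed.

Lemma pade_form_alt s t n : s != 0 -> 0 < t ->
  pade_form s t n * pade_form s t n.+1 < 0.
Proof.
move=> s0 t0; rewrite !pade_formE ?lt0r_neq0// mulrACA.
by rewrite pmulr_rlt0 ?pade_rem_alt ?mulr_gt0 ?exprn_gt0// mulf_neq0// invr_eq0 lt0r_neq0.
Qed.

Lemma pade_form_neq0 s t n : s != 0 -> 0 < t -> pade_form s t n != 0.
Proof.
move=> s0 t0; apply/eqP => h; have := @pade_form_alt s t n s0 t0.
by rewrite h mul0r ltxx.
Qed.

Lemma norm_pade_form_le s t n : s != 0 -> 0 < t ->
  `|pade_form s t n| <=
  s ^+ n.*2 * n`!%:R / (t ^+ n * (n.*2).+1`!%:R) * `|expR (s / t) - 1|.
Proof.
move=> s0 t0; rewrite pade_formE ?lt0r_neq0// normrM gtr0_norm ?exprn_gt0//.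
have x0 : s / t != 0 by rewrite mulf_neq0// invr_eq0 lt0r_neq0.
have := norm_pade_rem_le n x0.
rewrite -(ler_pM2l (exprn_gt0 n t0)) => /le_trans; apply.
rewrite expr_div_n -addnn !exprD le_eqVlt; apply/orP; left; apply/eqP.
by field; rewrite !expf_neq0 ?lt0r_neq0// ltr0n fact_gt0.
Qed.

(** The recurrence multiplies the determinant by -s^2, starting from (2t - s) - (2t + s). *)
Lemma pade_det (K : comNzRingType) (s t : K) n :
  pade (- s) t n.+1 * pade s t n - pade (- s) t n * pade s t n.+1 =
  - 2 * s * (- s ^+ 2) ^+ n.
Proof.
elim: n => [|n IH]; first by rewrite !pade0 !pade1; ring.
rewrite !pade_rec (exprS _ n); move: ((- s ^+ 2) ^+ n) IH => w IH.
transitivity (- s ^+ 2 * (pade (- s) t n.+1 * pade s t n - pade (- s) t n * pade s t n.+1)); first by ring.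
by rewrite IH; ring.
Qed.

Lemma pade_gt0 s t n : 0 < s -> 0 < t -> 0 < pade s t n.
Proof.
move=> s0 t0; suff : 0 < pade s t n /\ 0 < pade s t n.+1 by case.
elim: n => [|n [IH1 IH2]]; split => //.
- by rewrite pade0.
- by rewrite pade1 addr_gt0// mulr_gt0.
- by rewrite pade_rec addr_gt0// ?mulr_gt0 ?exprn_gt0 ?ltr0n ?addn_gt0 ?orbT.
Qed.

Lemma pade_le s t n : 0 < s -> 1 <= t -> pade s t n <= pade s t n.+1.
Proof.
move=> s0 t1; have t0 := lt_le_trans ltr01 t1.
case: n => [|n]; first by rewrite pade0 pade1; lra.
rewrite pade_rec; have /ltW h1 := pade_gt0 n s0 t0; have /ltW h2 := pade_gt0 n.+1 s0 t0.
rewrite -[leLHS]addr0 lerD ?mulr_ge0 ?exprn_ge0 ?(ltW s0)//.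
rewrite -[leLHS]mul1r ler_wpM2r// natrD natrM.
by have := ler0n R n; nra.
Qed.

(* Equals q_n for s < 0 and e^(-s/t) p_n for s > 0: whichever of p_n, q_n has
   only positive terms, rescaled so that the determinant with the Padé forms is
   the same in both cases. *)
Definition pade_abs s t n : R := Num.min 1 (expR (- (s / t))) * pade `|s| t n.

Lemma pade_absE s t n : s != 0 -> 0 < t -> pade_abs s t n =
  if 0 < s then expR (- (s / t)) * pade s t n else pade (- s) t n.
Proof.
rewrite /pade_abs neq_lt => /orP[s0|s0] t0.
  rewrite ltNge (ltW s0) /= ltr0_norm// min_l ?mul1r//.
  by rewrite leNgt expR_lt1 oppr_lt0 -leNgt pmulr_lle0 ?invr_gt0// ltW.
rewrite s0 gtr0_norm// min_r// expR_le1 oppr_le0 divr_ge0// ltW//.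
Qed.

Lemma pade_abs_gt0 s t n : s != 0 -> 0 < t -> 0 < pade_abs s t n.
Proof.
move=> s0 t0; rewrite /pade_abs mulr_gt0 ?pade_gt0 ?normr_gt0//.
by rewrite lt_min ltr01 expR_gt0.
Qed.

(** For s > 0, e^(-s/t) p_n = q_n - e^(-s/t) rho_n differs from q_n by a fixed multiple of rho_n,
    which leaves the determinant unchanged. *)
Lemma pade_abs_det s t n : s != 0 -> 0 < t ->
  pade_abs s t n.+1 * pade_form s t n - pade_abs s t n * pade_form s t n.+1 =
  2 * s * (- s ^+ 2) ^+ n.
Proof.
move=> s0 t0; have := pade_det s t n; rewrite !pade_absE// /pade_form expRN.
have := expR_gt0 (s / t); move: (expR _) => E E0 h.
move: ((- s ^+ 2) ^+ n) h => w h.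
have -> : 2 * s * w = - (- 2 * s * w) by ring.
rewrite -h; case: ifP => _; last by ring.
by field; rewrite lt0r_neq0.
Qed.

(** As [pade_abs] is positive and consecutive forms alternate in sign, the two terms of the
    determinant add up without cancellation, so each is bounded by the total. *)
Lemma pade_abs_form s t n : s != 0 -> 0 < t ->
  pade_abs s t n.+1 * `|pade_form s t n| <= 2 * `|s| ^+ n.*2.+1.
Proof.
move=> s0 t0; have := pade_abs_det n s0 t0; have := pade_form_alt n s0 t0.
have := pade_abs_gt0 n s0 t0; have := pade_abs_gt0 n.+1 s0 t0.
move: (pade_abs s t n.+1) (pade_abs s t n) (pade_form s t n) (pade_form s t n.+1).
move=> a b u v a0 b0 uv h.
have -> : 2 * `|s| ^+ n.*2.+1 = `|a * u - b * v|.
  by rewrite h !normrM normrX normrN normrX normr_nat -exprM mul2n exprS; ring.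
have [u0|u0|u0] := ltgtP u 0; last by rewrite u0 normr0 mulr0.
- have v0 : 0 < v by nra.
  rewrite ltr0_norm// ler0_norm; nra.
- have v0 : v < 0 by nra.
  rewrite gtr0_norm// ger0_norm; nra.
Qed.

(** Returns from [pade_abs] to q_n: for s > 0 they differ by e^(-s/t) rho_n, and e^(-s/t) <=
    1/(e^(s/t) - 1). The extra term leads to the last summand of [Zfun]. *)
Lemma norm_pade_le s t n : s != 0 -> 0 < t -> `|pade (- s) t n| <=
  pade_abs s t n + `|pade_form s t n| / `|expR (s / t) - 1|.
Proof.
move=> s0 t0; rewrite pade_absE//; case: ifP => s1; last first.
  rewrite gtr0_norm ?lerDl ?divr_ge0// pade_gt0// oppr_gt0.
  by rewrite lt_neqAle s0 leNgt s1.
have x0 : 0 < s / t by rewrite divr_gt0.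
have e1 : 1 < expR (s / t) by rewrite expR_gt1.
have -> : pade (- s) t n = expR (- (s / t)) * pade s t n + expR (- (s / t)) * pade_form s t n.
  by rewrite /pade_form expRN; field; rewrite expR_eq0.
apply: (le_trans (ler_normD _ _)); rewrite !normrM !(ger0_norm (expR_ge0 _)).
rewrite (gtr0_norm (pade_gt0 n s1 t0)) lerD2l mulrC ler_wpM2l// expRN.
have -> : `|expR (s / t) - 1| = expR (s / t) - 1 by rewrite ger0_norm// subr_ge0 ltW.
rewrite lef_pV2 ?posrE ?subr_gt0 ?expR_gt0//.
by rewrite gerBl.
Qed.

Lemma pade_abs_le s t n : s != 0 -> 1 <= t -> pade_abs s t n <= pade_abs s t n.+1.
Proof.
move=> s0 t1; by rewrite ler_wpM2l ?pade_le ?normr_gt0.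
Qed.

Lemma pade_abs_step s t n : s != 0 -> 1 <= t ->
  pade_abs s t n.+2 <= ((4 * n + 6)%:R * t + s ^+ 2) * pade_abs s t n.+1.
Proof.
move=> s0 t1; rewrite {1}/pade_abs pade_rec real_normK ?num_real//.
rewrite mulrDr [leRHS]mulrDl lerD//; first by rewrite mulrCA.
by rewrite mulrCA ler_wpM2l ?sqr_ge0// pade_abs_le.
Qed.

End Forms.

(** * Real estimates *)

Section Estimates.
Local Open Scope classical_set_scope.
Local Open Scope ring_scope.
Context {R : realType}.

Lemma alpha_gt0 s : 0 < alpha R s.
Proof.
rewrite /alpha big_seq; elim/big_ind: _ => // [a b|p]; first exact: mulr_gt0.
by rewrite mem_primes => /and3P[pp _ _]; rewrite powR_gt0// ltr0n prime_gt0.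
Qed.

(** Each factor p^(1/(p-1)) is at most p, and the product of the primes dividing s divides s. Hence
    powers of |s|/alpha grow with the exponent. *)
Lemma alpha_le s : s != 0 -> alpha R s <= `|s%:~R|.
Proof.
move=> s0; apply: (@le_trans _ _ (\prod_(p <- primes `|s|%N) p%:R)).
  rewrite /alpha big_seq [leRHS]big_seq; apply: ler_prod => p.
  rewrite mem_primes => /and3P[pp _ _]; rewrite powR_ge0 /=.
  have p2 : 2 <= p%:R :> R by rewrite ler_nat prime_gt1.
  by rewrite ler1_powR ?invf_le1; lra.
rewrite -intr_norm -abszE -natr_prod -pmulrn ler_nat dvdn_leq ?absz_gt0//.
rewrite (eq_bigr (fun p => p ^ 1))%N; last by move=> p _; rewrite expn1.
apply: dvdn_prod_primes; [exact: primes_uniq|exact: all_prime_primes|].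
by move=> p; rewrite expn1 mem_primes => /and3P[].
Qed.

Lemma powR_prime_le (p n : nat) : prime p -> (0 < n)%N ->
  (p%:R `^ (p%:R - 1)^-1) ^+ n <= p%:R * n%:R * p%:R ^+ logn p n`! :> R.
Proof.
move=> pp n0; have p1 : 1 < p%:R :> R by rewrite ltr1n prime_gt1.
have p0 : 0 <= p%:R :> R by rewrite ler0n.
rewrite -powR_mulrn ?powR_ge0// -powRrM.
apply: (@le_trans _ _ (p%:R `^ (logn p n`! + (trunc_log p n).+1)%:R)).
  rewrite ler_powR ?(ltW p1)// mulrC ler_pdivrMr ?subr_gt0// mulrC.
  have <- : p.-1%:R = p%:R - 1 :> R.
    by rewrite -[in RHS](prednK (prime_gt0 pp)) -natr1 addrK.
  by rewrite -natrM ler_nat expn_fact_le.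
rewrite powR_mulrn// exprD mulrC exprS ler_wpM2r ?exprn_ge0// ler_wpM2l//.
by rewrite -natrX ler_nat trunc_logP// prime_gt1.
Qed.

(** Each odd prime p loses a factor p n by [powR_prime_le], which gives gamma n^beta in total; at p
    = 2 the factor is 2^n on both sides. *)
Lemma alpha_exp_le s n : (0 < n)%N ->
  alpha R s ^+ n <= (gam s)%:R * n%:R ^+ beta s * (padeden s n)%:R.
Proof.
move=> n0; rewrite /alpha /gam /beta /padeden -prodrXl.
have -> : n%:R ^+ count (fun p => p != 2%N) (primes `|s|%N) =
    \prod_(p <- primes `|s|%N) (if p != 2%N then n%:R else 1) :> R.
  by rewrite -big_mkcond big_const_seq iter_mulr mulr1.
have -> : (\prod_(p <- primes `|s| | p != 2) p)%N%:R =
    \prod_(p <- primes `|s|%N) (if p != 2%N then p%:R else 1) :> R.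
  by rewrite natr_prod big_mkcond.
rewrite natr_prod -!big_split/=.
rewrite big_seq [leRHS]big_seq; apply: ler_prod => p.
rewrite mem_primes => /and3P[pp _ _]; rewrite exprn_ge0 ?powR_ge0 //=.
rewrite /padeden_exp; case: eqP => [->|_] /=; last by rewrite natrX powR_prime_le.
rewrite !mul1r natrX (_ : 2 - 1 = 1) ?invr1 ?powRr1//; lra.
Qed.

Lemma ln_lt_subr1 (u : R) : 0 < u -> u != 1 -> ln u < u - 1.
Proof.
move=> u0 u1; have l0 : ln u != 0 by rewrite ln_eq0.
by have := expR_gt1Dx l0; rewrite lnK ?posrE//; lra.
Qed.

(** From ln a - ln b < a/b - 1 one gets b ln b - a ln a > (b - a)(ln b + a/b). The last factor is
    nonnegative because ln(1/(eb)) <= 1/(eb) - 1 and 1/e <= a. *)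
Lemma mulln_lt (a b : R) : (expR 1)^-1 <= a -> a < b -> a * ln a < b * ln b.
Proof.
move=> ea ab; have a0 : 0 < a by apply: lt_le_trans ea; rewrite invr_gt0 expR_gt0.
have b0 := lt_trans a0 ab.
have h1 : ln a - ln b < a / b - 1.
  rewrite -ln_div ?posrE//; apply: ln_lt_subr1; first by rewrite divr_gt0.
  by rewrite lt_eqF// ltr_pdivrMr// mul1r.
have h2 : - 1 - ln b <= a / b - 1.
  have e0 : 0 < (expR 1 * b)^-1 by rewrite invr_gt0 mulr_gt0// expR_gt0.
  have := @le_ln1Dx R ((expR 1 * b)^-1 - 1) ltac:(lra).
  rewrite (_ : 1 + (_ - 1) = (expR 1 * b)^-1); last by ring.
  rewrite lnV ?posrE ?mulr_gt0 ?expR_gt0// lnM ?posrE ?expR_gt0// expRK.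
  have : (expR 1 * b)^-1 <= a / b by rewrite invfM ler_pM2r// invr_gt0.
  lra.
have h3 : a / b * b = a by rewrite divfK// lt0r_neq0.
have : 0 <= (b - a) * (ln b + a / b) by apply: mulr_ge0; lra.
have : 0 < a * (a / b - 1 - (ln a - ln b)) by apply: mulr_gt0; lra.
rewrite -subr_gt0; nra.
Qed.

(** Since ln >= 1 beyond e, c ln c <= v <= v ln v, and the intermediate value theorem gives a
    preimage of v in [c, v]. By [mulln_lt] it is the only one, hence the value of the partial
    inverse. *)
Lemma zinv_spec (c v : R) : expR 1 <= c -> c * ln c <= v ->
  c <= zinv v /\ zinv v * ln (zinv v) = v.
Proof.
move=> ec cv; have e0 := expR_gt0 (1 : R).
have e1 : 1 < expR 1 :> R by rewrite expR_gt1.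
have c0 : 0 < c by lra.
have lnc : 1 <= ln c by rewrite -[leLHS]expRK ler_ln ?posrE.
have v0 : c <= v by nra.
have lnv : 1 <= ln v by rewrite (le_trans lnc)// ler_ln ?posrE//; lra.
have [w wcv wv] : exists2 w, w \in `[c, v] & w * ln w = v.
  apply: IVT => //.
    apply: continuous_in_subspaceT => x; rewrite inE/= in_itv/= => /andP[cx _].
    by apply: cvgM; [exact: cvg_id|apply: continuous_ln; lra].
  by rewrite ge_min le_max cv /=; apply/orP; right; nra.
have -> : zinv v = w; last by move: wcv; rewrite in_itv/= => /andP[].
rewrite /zinv -wv; apply: pinvKV.
  move=> x y; rewrite !inE/= => ex ey exy; apply/eqP.
  have [xy|xy|//] := ltgtP x y; first by have := mulln_lt ex xy; rewrite exy ltxx.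
  by have := mulln_lt ey xy; rewrite exy ltxx.
rewrite inE/=; move: wcv; rewrite in_itv/= => /andP[cw _].
by rewrite (@le_trans _ _ 1)// ?invf_le1//; lra.
Qed.

(** Right side minus left side vanishes at 0 and has derivative -ln(1 - w^2) >= 0. *)
Lemma ln_ratio_le (w : R) : 0 < w -> w < 1 ->
  (1 + w) * ln (1 + w) - (1 - w) * ln (1 - w) <= 2 * w.
Proof.
move=> w0 w1.
pose g (x : R) := x * ln x.
have dg (x : R) : 0 < x -> is_derive x 1 g (ln x + 1).
  move=> x0; have dl := is_derive1_ln x0.
  apply: is_derive_eq.
  by rewrite /GRing.scale/= mulr1 divff ?lt0r_neq0// addrC.
pose f (x : R) := 2 * x - (g (1 + x) - g (1 - x)).
have df (x : R) : 0 <= x < 1 -> is_derive x 1 f (- ln (1 - x ^+ 2)).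
  move=> /andP[x0 x1].
  have d1 : is_derive x 1 (fun y => g (1 + y)) (ln (1 + x) + 1).
    have dh : is_derive x 1 (fun y : R => 1 + y) 1.
      by apply: is_derive_eq; rewrite /GRing.scale/=; ring.
    have dgx := dg (1 + x) ltac:(lra).
    have := @is_derive1_comp R g (fun y => 1 + y) x _ _ dgx dh.
    by rewrite mulr1.
  have d2 : is_derive x 1 (fun y => g (1 - y)) (- (ln (1 - x) + 1)).
    have dh : is_derive x 1 (fun y : R => 1 - y) (-1).
      by apply: is_derive_eq; rewrite /GRing.scale/=; ring.
    have dgx := dg (1 - x) ltac:(lra).
    have := @is_derive1_comp R g (fun y => 1 - y) x _ _ dgx dh.
    by rewrite mulrN1.
  have -> : 1 - x ^+ 2 = (1 + x) * (1 - x) by ring.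
  rewrite lnM ?posrE; [|lra|lra].
  rewrite /f; apply: is_derive_eq.
  rewrite /GRing.scale/=; ring.
have cf : {within `[0, w], continuous f}.
  apply: derivable_within_continuous => x; rewrite in_itv/= => /andP[x0 xw].
  by have [] := df x ltac:(lra).
have [|c] := @MVT R f (fun x => - ln (1 - x ^+ 2)) 0 w w0 _ cf.
  by move=> x; rewrite in_itv/= => /andP[x0 xw]; apply: df; lra.
rewrite in_itv/= => /andP[c0 cw] h.
have : 0 <= f w - f 0.
  rewrite h mulr_ge0 ?subr0 ?(ltW w0)// oppr_ge0 ln_le0//; nra.
by rewrite /f /g !subr0 !addr0 subrr mulr0 !subr0; lra.
Qed.

(** For m > 0 the logarithm of the claim is half of [ln_ratio_le] at w = 1/(2m+1), scaled by 2m+1.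
    For m = 0 it reads 2 <= e, with 0^0 = 1. *)
Lemma ratio_le_expR (m : nat) :
  2 * m.+1%:R ^+ m.+1 <= expR 1 * (2 * m + 1)%:R * m%:R ^+ m :> R.
Proof.
case: m => [|m].
  have := expR_ge1Dx (1 : R); rewrite expr1 expr0; lra.
set M := m.+1%:R; have M1 : 1 <= M :> R by rewrite ler1n.
have -> : m.+2%:R = M + 1 by rewrite natr1.
have -> : (2 * m.+1 + 1)%:R = 2 * M + 1 :> R by rewrite natrD natrM.
have p1 : 0 < 2 * M + 1 :> R by lra.
have i0 : 0 < (2 * M + 1)^-1 by rewrite invr_gt0.
have i1 : (2 * M + 1)^-1 < 1 by rewrite invf_lt1//; lra.
have := ln_ratio_le i0 i1.
have -> : 1 + (2 * M + 1)^-1 = (2 * M + 2) / (2 * M + 1) by field; lra.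
have -> : 1 - (2 * M + 1)^-1 = 2 * M / (2 * M + 1) by field; lra.
rewrite -(ler_pM2l p1) => h1.
have h : (2 * M + 2) * ln ((2 * M + 2) / (2 * M + 1)) - 2 * M * ln (2 * M / (2 * M + 1)) <= 2.
  rewrite (le_trans _ (le_trans h1 _))// le_eqVlt; apply/orP; left; apply/eqP.
    by field; lra.
  by field; lra.
move: h; rewrite (_ : 2 * M + 2 = 2 * (M + 1)); last by ring.
have M0 : 0 < M by lra.
have M2 : 0 < M + 1 by lra.
have pM : 0 < M ^+ m.+1 by rewrite exprn_gt0.
have pM1 : 0 < (M + 1) ^+ m.+2 by rewrite exprn_gt0.
have e0 := expR_gt0 (1 : R).
move: (lnXn m.+1 M0) (lnXn m.+2 M2).
move: (M ^+ m.+1) ((M + 1) ^+ m.+2) pM pM1 => a b a0 b0 la lb.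
rewrite -ler_ln ?posrE ?mulr_gt0//.
rewrite !ln_div ?posrE ?mulr_gt0// !lnM ?posrE ?mulr_gt0// la lb expRK.
rewrite -[ln (M + 1) *+ _]mulr_natl -[ln M *+ _]mulr_natl -/M (_ : m.+2%:R = M + 1) ?natr1//.
move: (ln 2) (ln M) (ln (M + 1)) (ln (2 * M + 1)) => x y z u; nra.
Qed.

(** Stirling-type bound (2m)!/m! >= (4m/e)^m, the origin of 4/e in [sigma]. Its induction step is
    [ratio_le_expR]. *)
Lemma expn_le_fact (m : nat) :
  (4 * m)%:R ^+ m * m`!%:R <= expR 1 ^+ m * (m.*2)`!%:R :> R.
Proof.
elim: m => [|m IH]; first by rewrite !expr0.
have e0 := expR_gt0 (1 : R).
rewrite doubleS [m.+1`!]factS [m.*2.+2`!]factS [m.*2.+1`!]factS !natrM.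
have -> : m.*2.+2%:R = 2 * m.+1%:R :> R by rewrite -natrM mul2n doubleS.
have -> : m.*2.+1%:R = (2 * m + 1)%:R :> R by rewrite addn1 mul2n.
move: IH (ratio_le_expR m); rewrite !natrM !exprMn (exprS 4) (exprS (expR 1)).
have [F0 G0] : 0 <= m`!%:R :> R /\ 0 <= (m.*2)`!%:R :> R by rewrite !ler0n.
have H0 : 0 <= (2 * m + 1)%:R :> R by rewrite ler0n.
have M0 : 0 <= m.+1%:R :> R by rewrite ler0n.
have P0 : 0 <= 4 ^+ m :> R by rewrite exprn_ge0.
move: (m.+1%:R ^+ m.+1) (m%:R ^+ m) (expR 1 ^+ m) => X Y E.
move: (4 ^+ m) (m`!%:R) (m.*2`!%:R) ((2 * m + 1)%:R) (m.+1%:R) (expR 1) P0 F0 G0 H0 M0 e0.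
move=> P F G H M e P0 F0 G0 H0 M0 e0 IH h.
apply: (@le_trans _ _ (2 * P * M * F * (e * H * Y))).
  rewrite [leLHS](_ : _ = 2 * P * M * F * (2 * X)); last by ring.
  by rewrite ler_wpM2l// !mulr_ge0.
rewrite [leLHS](_ : _ = 2 * e * M * H * (P * Y * F)); last by ring.
rewrite [leRHS](_ : _ = 2 * e * M * H * (E * G)); last by ring.
by rewrite ler_wpM2l// !mulr_ge0// ltW.
Qed.

End Estimates.

(** * Rational approximation of the exponential *)

Section RationalApproximation.
Context {R : realType} (s t : int) (s0 : s != 0) (t1 : 1 <= t).

Local Notation S := (s%:~R : R).
Local Notation T := (t%:~R : R).
Local Notation A := (alpha R s).
Local Notation G := ((gam s)%:R : R).
Local Notation D n := ((padeden s n)%:R : R).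
Local Notation rho n := (pade_form S T n).
Local Notation E := (`|expR (S / T) - 1|).
Local Notation sg := (sigma R s t).
Local Notation b := (beta s).

Let S0 : S != 0. Proof. by rewrite intr_eq0. Qed.
Let T1 : 1 <= T. Proof. by rewrite ler1z. Qed.
Let T0 : 0 < T. Proof. exact: lt_le_trans T1. Qed.
Let A0 : 0 < A. Proof. exact: alpha_gt0. Qed.
Let D0 n : 0 < D n. Proof. by rewrite ltr0n padeden_gt0. Qed.

Lemma gam_ge1 : 1 <= G.
Proof.
rewrite ler1n /gam big_seq_cond; elim/big_ind: _ => // [x y|p].
  by rewrite muln_gt0 => -> ->.
by rewrite mem_primes => /andP[/and3P[pp _ _] _]; rewrite prime_gt0.
Qed.

Lemma sigma_gt0 : 0 < sg.
Proof.
have S2 : 0 < S ^+ 2 by rewrite exprn_even_gt0.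
rewrite /sigma divr_gt0//; first by rewrite !mulr_gt0.
by rewrite mulr_gt0// expR_gt0.
Qed.

Lemma expm1_gt0 : 0 < E.
Proof.
have x0 : S / T != 0 by rewrite mulf_neq0 ?invr_eq0 ?(lt0r_neq0 T0).
rewrite normr_gt0 subr_eq0; apply: contra x0 => /eqP h.
by apply/eqP/expR_inj; rewrite h expR0.
Qed.

(** With this [sigma], the product of (sigma m)^m and the bound on |rho_m| collapses to alpha^m
    times a quotient at most 1 by [expn_le_fact]; then [alpha_exp_le] trades alpha^m for D_m. *)
Lemma pade_form_le_sigma m : (0 < m)%N ->
  2 * (m%:R + 2^-1) * (sg * m%:R) ^+ m * `|rho m| <= E * G * m%:R ^+ b * D m.
Proof.
move=> m0; have m0' : 0 < m%:R :> R by rewrite ltr0n.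
have h1 := norm_pade_form_le m S0 T0.
have h2 := alpha_exp_le (R := R) s m0.
have h3 := expn_le_fact (R := R) m.
have e0 := expR_gt0 (1 : R).
have sgm : (sg * m%:R) ^+ m = T ^+ m * A ^+ m * (4 * m)%:R ^+ m / (expR 1 ^+ m * S ^+ m.*2).
  rewrite -[m.*2]mul2n exprM -!exprMn -expr_div_n natrM; congr (_ ^+ _).
  by rewrite /sigma; field; rewrite S0 lt0r_neq0.
have S2 : 0 < S ^+ m.*2 by rewrite -mul2n exprM exprn_gt0// exprn_even_gt0.
have Tm : 0 < T ^+ m by rewrite exprn_gt0.
have em : 0 < expR 1 ^+ m :> R by rewrite exprn_gt0.
have f0 : 0 < m`!%:R :> R by rewrite ltr0n fact_gt0.
have f1 : 0 < m.*2`!%:R :> R by rewrite ltr0n fact_gt0.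
have Am : 0 < A ^+ m by rewrite exprn_gt0.
have ff : (m.*2).+1`!%:R = 2 * (m%:R + 2^-1) * m.*2`!%:R :> R.
  by rewrite factS natrM -natr1 -mul2n natrM; congr (_ * _); field.
rewrite sgm; rewrite ff in h1.
have E0 := expm1_gt0.
move: (D0 m) h1 h2 h3 E0.
have q0 : 0 <= (4 * m)%:R ^+ m :> R by rewrite exprn_ge0.
move: (`|rho m|) E (D m) ((4 * m)%:R ^+ m : R) q0 => r x d q q0 d0 h1 h2 h3 x0.
have mh : 0 < m%:R + 2^-1 :> R by lra.
apply: (@le_trans _ _ (2 * (m%:R + 2^-1) * (T ^+ m * A ^+ m * q / (expR 1 ^+ m * S ^+ m.*2)) *
  (S ^+ m.*2 * m`!%:R / (T ^+ m * (2 * (m%:R + 2^-1) * (m.*2)`!%:R)) * x))).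
  rewrite ler_wpM2l// !mulr_ge0 ?invr_ge0 ?mulr_ge0 ?(ltW A0) ?(ltW Tm)//; try exact: ltW.
rewrite [leLHS](_ : _ = x * (A ^+ m * ((q * m`!%:R) / (expR 1 ^+ m * m.*2`!%:R)))); last first.
  by field; rewrite ?lt0r_neq0.
have hr : (q * m`!%:R) / (expR 1 ^+ m * m.*2`!%:R) <= 1.
  by rewrite ler_pdivrMr ?mulr_gt0// mul1r.
rewrite [leRHS](_ : _ = x * (G * m%:R ^+ b * d)); last by ring.
by rewrite ler_pM2l// (le_trans _ h2)// ger_pMr.
Qed.

(** If m > y + beta, then N = (sigma y)^y <= (sigma m)^(m - beta), and [pade_form_le_sigma] forces
    (m + 1/2) sigma^beta <= |e^(s/t) - 1| gamma. This contradicts the first entry of [eta], whose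
    factor sqrt(e/2) is at least 1. *)
Lemma pade_index_le (N y : R) m : (0 < m)%N -> 0 < N ->
  expR 1 <= sg * y -> ln N = y * ln (sg * y) ->
  Num.sqrt (expR 1) * E * G / (Num.sqrt 2 * sg ^+ b) - 2^-1 <= y + b%:R ->
  D m <= 2 * N * `|rho m| -> m%:R <= y + b%:R.
Proof.
move=> m0 N0 ey lN hy hD; rewrite leNgt; apply/negP => hm.
have e1 : 1 < expR 1 :> R by rewrite expR_gt1.
have e2 : 2 <= expR 1 :> R by have := expR_ge1Dx (1 : R); lra.
have sg0 := sigma_gt0; have E0 := expm1_gt0; have G1 := gam_ge1.
have m0' : 0 < m%:R :> R by rewrite ltr0n.
have y0 : 0 < y by rewrite -(pmulr_rgt0 _ sg0); lra.
have b0 : 0 <= b%:R :> R by [].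
have sgm0 : 0 < sg * m%:R by rewrite mulr_gt0.
have lsy : 0 <= ln (sg * y) by rewrite ln_ge0//; lra.
have lsm : ln (sg * y) <= ln (sg * m%:R).
  have sgy : sg * y <= sg * m%:R by rewrite ler_wpM2l ?(ltW sg0)//; lra.
  have sgy0 : 0 < sg * y by exact: mulr_gt0.
  by rewrite ler_ln ?posrE.
have big : N * (sg * m%:R) ^+ b <= (sg * m%:R) ^+ m.
  have ex k : (sg * m%:R) ^+ k = expR (k%:R * ln (sg * m%:R)).
    by rewrite expRM_natl lnK ?posrE.
  rewrite !ex -[N]lnK ?posrE// -expRD ler_expR lN.
  nra.
have h := pade_form_le_sigma m0.
have h2 : (m%:R + 2^-1) * sg ^+ b <= E * G.
  have mb : 0 < m%:R ^+ b :> R by rewrite exprn_gt0.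
  have r0 : 0 <= `|rho m| by [].
  have mh : 0 < m%:R + 2^-1 :> R by lra.
  have h3 : 2 * (m%:R + 2^-1) * (N * (sg * m%:R) ^+ b) * `|rho m| <= E * G * m%:R ^+ b * D m.
    apply: le_trans h; rewrite ler_wpM2r// ler_wpM2l// mulr_ge0//; lra.
  have c0 : 0 <= (m%:R + 2^-1) * sg ^+ b * m%:R ^+ b.
    by rewrite !mulr_ge0 ?exprn_ge0//; lra.
  have h4 : (m%:R + 2^-1) * sg ^+ b * m%:R ^+ b * D m <= E * G * m%:R ^+ b * D m.
    apply: (le_trans _ h3).
    rewrite [leRHS](_ : _ = (m%:R + 2^-1) * sg ^+ b * m%:R ^+ b * (2 * N * `|rho m|)).
      by rewrite ler_wpM2l.
    by rewrite exprMn; ring.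
  by move: h4; rewrite (ler_pM2r (D0 m)) (ler_pM2r mb).
have sb : 0 < sg ^+ b by rewrite exprn_gt0.
have h5 : E * G / sg ^+ b < m%:R + 2^-1.
  have s2 : 0 < Num.sqrt 2 :> R by rewrite sqrtr_gt0.
  apply: (@le_lt_trans _ _ (Num.sqrt (expR 1) * E * G / (Num.sqrt 2 * sg ^+ b))); last by lra.
  rewrite [leRHS](_ : _ = (Num.sqrt (expR 1) / Num.sqrt 2) * (E * G / sg ^+ b)); last first.
    by field; rewrite !lt0r_neq0.
  have q1 : 1 <= Num.sqrt (expR 1) / Num.sqrt 2 :> R.
    by rewrite ler_pdivlMr// mul1r ler_sqrt//; lra.
  have x0 : 0 <= E * G / sg ^+ b by rewrite divr_ge0 ?mulr_ge0 ?(ltW sb).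
  by rewrite ler_peMl.
by move: h5; rewrite ltr_pdivrMr// ltNge h2.
Qed.

(** The determinant bound and the lower bound on |rho_m| give pade_abs_(m+1) D_m <= 4 N |s|^(2m+1).
    Splitting alpha^(2m+1) as alpha^m alpha^(m+1) then accounts for both D_m and D_(m+1). *)
Lemma pade_abs_div_le (N : R) m : (0 < m)%N -> 0 < N ->
  D m <= 2 * N * `|rho m| ->
  pade_abs S T m.+1 / D m.+1 <=
  4 * N * G ^+ 2 * m%:R ^+ b * m.+1%:R ^+ b * (`|S| / A) ^+ m.*2.+1.
Proof.
move=> m0 N0 hD; have h := pade_abs_form m S0 T0.
have a1 := alpha_exp_le (R := R) s m0; have a2 := alpha_exp_le (R := R) s (ltn0Sn m).
have B0 := pade_abs_gt0 m.+1 S0 T0.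
have G1 := gam_ge1.
rewrite ler_pdivrMr//.
have h1 : pade_abs S T m.+1 * D m <= 4 * N * `|S| ^+ m.*2.+1.
  apply: (@le_trans _ _ (pade_abs S T m.+1 * (2 * N * `|rho m|))).
    by rewrite ler_wpM2l// ltW.
  rewrite mulrCA [leRHS](_ : _ = 2 * N * (2 * `|S| ^+ m.*2.+1)); last by ring.
  by rewrite ler_wpM2l// mulr_ge0// ltW.
have h2 : A ^+ m.*2.+1 <= G * m%:R ^+ b * D m * (G * m.+1%:R ^+ b * D m.+1).
  by rewrite -addnn -addnS exprD ler_pM ?exprn_ge0 ?(ltW A0).
rewrite -(ler_pM2r (D0 m)) (le_trans h1)//.
rewrite expr_div_n.
have Ap : 0 < A ^+ m.*2.+1 by rewrite exprn_gt0.
rewrite [leRHS](_ : _ = 4 * N * `|S| ^+ m.*2.+1 *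
  ((G * m%:R ^+ b * D m * (G * m.+1%:R ^+ b * D m.+1)) / A ^+ m.*2.+1)); last first.
  by field; rewrite ?lt0r_neq0 ?exprn_gt0.
by rewrite ler_peMr ?mulr_ge0 ?exprn_ge0 ?(ltW N0)// ler_pdivlMr ?mul1r.
Qed.

Lemma norm_pade_Zfun_le (N : int) m k :
  (0 < m)%N -> 0 < N%:~R :> R -> m%:R <= zeta R s t N ->
  D m <= 2 * N%:~R * `|rho m| ->
  2 * N%:~R * `|rho k| < D k -> (k == m.+1) || (k == m.+2) ->
  2 * N%:~R * `|pade (- S) T k| <=
  N%:~R ^+ 2 * (`|S| / A) `^ (2 * (zeta R s t N - b%:R)) * Zfun R s t N * D k.
Proof.
move=> m0 N0 mz hm hk hkm; rewrite /Zfun.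
have h := pade_abs_div_le m0 N0 hm.
have E0 := expm1_gt0.
have G1 := gam_ge1.
move: (zeta R s t N) mz => z mz.
have m1 : 1 <= m%:R :> R by rewrite ler1n.
set r := `|S| / A; set n := (N%:~R : R).
have r1 : 1 <= r by rewrite ler_pdivlMr// mul1r alpha_le.
have r0 : 0 < r by lra.
have rE : S ^+ 2 / A ^+ 2 = r ^+ 2 by rewrite /r expr_div_n real_normK ?num_real.
rewrite -/r in h; rewrite rE exprMn.
(* [V] bounds the recurrence factor from m+1 to m+2; being at least 1, it also serves k = m+1. *)
set V := 4 * T * z + 6 * T + S ^+ 2.
set P := r `^ (2 * (z - b%:R)).
have rpow j : j%:R <= z -> r ^+ (2 * j) <= P * (r ^+ 2) ^+ b.
  move=> jz; rewrite -!exprM -!powR_mulrn ?(ltW r0)// -powRD; last by rewrite (gt_eqF r0) implybT.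
  by apply: ler_powR => //; rewrite !natrM; lra.
have P0 : 0 < P by rewrite powR_gt0.
have z0 : 0 <= z by lra.
have zb : m%:R ^+ b <= z ^+ b by rewrite lerXn2r ?nnegrE.
have mz1 : m.+1%:R <= z + 1 by rewrite -natr1; lra.
have z10 : 0 <= z + 1 by lra.
have zb1 : m.+1%:R ^+ b <= (z + 1) ^+ b by rewrite lerXn2r ?nnegrE.
have z1b : 1 <= (z + 1) ^+ b by rewrite exprn_ege1//; lra.
have V1 : 1 <= V by rewrite /V; have := sqr_ge0 S; have := mulr_ge0 (ltW T0) z0; have := T1; lra.
set U := 4 * n * G ^+ 2 * z ^+ b * (z + 1) ^+ b * (r * (P * (r ^+ 2) ^+ b)).
have U0 : 0 <= U.
  by rewrite /U !mulr_ge0 ?exprn_ge0 ?invr_ge0//; exact: ltW.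
have hU : pade_abs S T m.+1 / D m.+1 <= U.
  apply: (le_trans h); rewrite [r ^+ _]exprS -mul2n.
  have c0 : 0 <= 4 * n * G ^+ 2 by rewrite !mulr_ge0 ?exprn_ge0//; exact: ltW.
  rewrite /U -/n; move: (4 * n * G ^+ 2) c0 => c c0.
  apply: ler_pM.
  - by rewrite !mulr_ge0 ?exprn_ge0.
  - by rewrite mulr_ge0 ?exprn_ge0// ltW.
  - by apply: ler_pM; rewrite ?mulr_ge0 ?exprn_ge0//; apply: ler_wpM2l.
  - by apply: ler_wpM2l; [exact: ltW|exact: rpow].
have hB : pade_abs S T k <= U * V * D k.
  have hB1 : pade_abs S T m.+1 <= U * D m.+1 by rewrite -ler_pdivrMr.
  case/orP: hkm => /eqP ->.
    by rewrite (le_trans hB1)// ler_wpM2r ?(ltW (D0 _))// ler_peMr.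
  apply: (le_trans (pade_abs_step m S0 T1)).
  have V0 : 0 <= (4 * m + 6)%:R * T + S ^+ 2.
    by rewrite addr_ge0 ?sqr_ge0// mulr_ge0// ltW.
  apply: (@le_trans _ _ (V * (U * D m.+1))).
    rewrite ler_pM ?(ltW (pade_abs_gt0 _ S0 T0))//.
    by rewrite /V natrD natrM; have := T1; have := mz; nra.
  rewrite mulrA [V * U]mulrC ler_wpM2l//; first by rewrite mulr_ge0//; lra.
  by rewrite ler_nat padeden_le.
have hq := norm_pade_le k S0 T0.
set g := (gcdz 2 s)%:~R.
have g1 : 1 <= g :> R.
  by rewrite /g ler1z lez_nat gcdn_gt0.
(* The last summand of [Zfun] absorbs 2N|rho_k|/E < D_k/E. Its denominator S^2 is compensated by
   [rpow] at exponent 1, as 1 <= m <= zeta(N). *)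
have hlast : E^-1 <= n ^+ 2 * P * ((r ^+ 2) ^+ b * (z + 1) ^+ b * (g * A ^+ 2 * G / (n ^+ 2 * S ^+ 2 * E))).
  have -> : S ^+ 2 = r ^+ 2 * A ^+ 2 by rewrite -rE divfK// expf_neq0// lt0r_neq0.
  rewrite [leRHS](_ : _ = E^-1 * ((P * (r ^+ 2) ^+ b / r ^+ 2) * ((z + 1) ^+ b * (g * G)))); last first.
    by field; rewrite ?(lt0r_neq0 r0) ?(lt0r_neq0 A0) ?(lt0r_neq0 E0) ?(lt0r_neq0 N0).
  rewrite ler_peMr ?invr_ge0 ?(ltW E0)//.
  have hr : 1 <= P * (r ^+ 2) ^+ b / r ^+ 2.
    by rewrite ler_pdivlMr ?exprn_gt0// mul1r; apply: (rpow 1%N); lra.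
  by apply: mulr_ege1 => //; apply: mulr_ege1 => //; apply: mulr_ege1.
apply: (@le_trans _ _ (2 * n * (U * V) * D k + E^-1 * D k)).
  apply: (@le_trans _ _ (2 * n * (pade_abs S T k + `|rho k| / E))).
    by rewrite ler_wpM2l// mulr_ge0// ltW.
  rewrite mulrDr; apply: lerD.
    by rewrite -[leRHS]mulrA ler_wpM2l// mulr_ge0// ltW.
  by rewrite mulrA [leRHS]mulrC; apply: ler_wpM2r; rewrite ?invr_ge0 ltW.
rewrite -mulrDl ler_wpM2r ?(ltW (D0 _))//.
rewrite [in leRHS]mulrDr [leRHS]mulrDr lerD//.
rewrite le_eqVlt; apply/orP; left; apply/eqP.
by rewrite /U /r; field; rewrite lt0r_neq0.
Qed.

End RationalApproximation.

(** * Choice of the index and conclusion *)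

Theorem theorem1 (R : realType) (s t : int) (hs : s != 0) (ht : 1 <= t)
    (hst : coprimez s t) (M N : int) (hM : M != 0) (hN : N1 R s t <= N%:~R) :
  1 < `|expR (s%:~R / t%:~R) - M%:~R / N%:~R| * Zfun R s t N *
      N%:~R `^ (2 + 2 * ln (`|s%:~R| / alpha R s) *
                    zinv (sigma R s t * ln N%:~R) /
                    (sigma R s t * ln N%:~R)).
Proof.
have N0 : 0 < N%:~R :> R by apply: lt_le_trans hN; rewrite expR_gt0.
have sg0 := sigma_gt0 (R := R) hs ht.
have e0 := expR_gt0 (1 : R).
have S0 : s%:~R != 0 :> R by rewrite intr_eq0.
have T1 : 1 <= t%:~R :> R by rewrite ler1z.
have T0 := lt_le_trans ltr01 T1.
have D0 n : 0 < (padeden s n)%:R :> R by rewrite ltr0n padeden_gt0.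
have lN : logN1 R s t <= ln N%:~R by rewrite -ler_expR lnK ?posrE.
move: lN; rewrite /logN1 ge_max => /andP[lN1 lN2].
set sg := sigma R s t in sg0 lN1 *; set L := ln N%:~R in lN1 lN2 *.
(* The first entry of [logN1] says c ln c <= sigma log N, and the second entry of [eta] says c >= e,
   as [zinv_spec] requires. *)
set c := sg * (Defs.eta R s t - (beta s)%:R) in lN1.
have ec : expR 1 <= c.
  rewrite /c mulrC -ler_pdivrMr// lerBrDr /Defs.eta le_max.
  by apply/orP; right.
have [cw wE] : c <= zinv (sg * L) /\ zinv (sg * L) * ln (zinv (sg * L)) = sg * L.
  by apply: zinv_spec => //; rewrite /c -mulrA ler_pM2l.
set w := zinv (sg * L) in cw wE *.
set y := w / sg.
have yE : sg * y = w by rewrite /y mulrC divfK// lt0r_neq0.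
have w0 : 0 < w by lra.
have zE : zeta R s t N = y + (beta s)%:R by [].
have LE : L = y * ln (sg * y).
  by rewrite yE /y mulrAC wE mulrC mulKf// lt0r_neq0.
have etaz : Defs.eta R s t <= y + (beta s)%:R.
  by rewrite -lerBlDr -(ler_pM2l sg0) yE.
(* Index 1 satisfies [P] by the second entry of [logN1], whose denominator is |2 rho_1|;
   [pade_index_le] bounds all such indices, so a largest one exists. *)
pose P m := (0 < m)%N &&
  ((padeden s m)%:R <= 2 * N%:~R * `|pade_form s%:~R t%:~R m| :> R).
have P1 : P 1%N.
  rewrite /P /=; have h1 := pade_form_neq0 1 S0 T0.
  have f1 : 4 * s%:~R + 2 * (s%:~R - 2 * t%:~R) * (expR (s%:~R / t%:~R) - 1) =
     - 2 * pade_form s%:~R t%:~R 1 :> R.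
    by rewrite /pade_form !pade1; ring.
  move: lN2; rewrite f1 -[(gcdz 2 s)](padeden1 hs) normrM normrN normr_nat.
  rewrite ler_ln ?posrE ?divr_gt0 ?mulr_gt0 ?normr_gt0 ?D0//.
  by rewrite ler_pdivrMr ?mulr_gt0 ?normr_gt0// mulrCA mulrA.
have Pz m : P m -> m%:R <= y + (beta s)%:R :> R.
  move=> /andP[m0 hm]; apply: (pade_index_le hs ht m0 N0 _ LE _ hm).
    by rewrite yE; lra.
  by apply: le_trans etaz; rewrite /Defs.eta le_max lexx.
have Pb m : P m -> (m <= Num.truncn (y + (beta s)%:R))%N.
  move=> /Pz h; rewrite truncn_ge_nat//; exact: le_trans h.
have [m Pm mmax] := ex_maxnP (ex_intro _ 1%N P1) Pb.
have /andP[m0 hm] := Pm.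
have small k : (m < k)%N ->
    2 * N%:~R * `|pade_form s%:~R t%:~R k| < (padeden s k)%:R :> R.
  move=> mk; rewrite ltNge; apply/negP => h.
  have : P k by rewrite /P h (leq_trans _ mk).
  by move=> /mmax; rewrite leqNgt mk.
have Nz : N != 0 by rewrite -(intr_eq0 R) lt0r_neq0.
(* If both combinations vanished, so would N times the determinant of the two consecutive pairs. *)
have [k hk kn0] : exists2 k, (k == m.+1) || (k == m.+2) &
    pade (- s) t k * M - pade s t k * N != 0.
  have [h1|h1] := eqVneq (pade (- s) t m.+1 * M - pade s t m.+1 * N) 0; last first.
    by exists m.+1; rewrite ?eqxx.
  exists m.+2; rewrite ?eqxx ?orbT//; apply/eqP => h2.
  have := pade_det s t m.+1 => hd.
  have : (pade (- s) t m.+2 * pade s t m.+1 - pade (- s) t m.+1 * pade s t m.+2) * N = 0.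
    transitivity (pade (- s) t m.+1 * (pade (- s) t m.+2 * M - pade s t m.+2 * N) -
      pade (- s) t m.+2 * (pade (- s) t m.+1 * M - pade s t m.+1 * N)); first by ring.
    by rewrite h1 h2 !mulr0 subrr.
  apply/eqP; rewrite hd mulf_neq0// mulf_neq0 ?mulf_neq0//.
  by rewrite expf_neq0// oppr_eq0 expf_neq0.
have mk : (m < k)%N by case/orP: hk => /eqP ->; rewrite ltnS ?leqnSn.
have kD : (padeden s k)%:R <= `|(pade (- s) t k * M - pade s t k * N)%:~R| :> R.
  have [Q hQ] := padeden_dvd t k (s := - s) ltac:(by rewrite oppr_eq0).
  have [Q' hQ'] := padeden_dvd t k hs.
  move: kn0; rewrite hQ hQ' padedenN -!mulrA -mulrBr mulf_eq0 negb_or => /andP[_ q0].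
  rewrite intrM normrM -pmulrn normr_nat ler_peMr//.
  by rewrite -intr_norm ler1z -gtz0_ge1 normr_gt0.
have sk := small k mk.
have zb := norm_pade_Zfun_le hs ht m0 N0 (Pz _ Pm) hm sk hk.
set Lam := `|expR (s%:~R / t%:~R) - M%:~R / N%:~R|.
have L0 : 0 <= Lam := normr_ge0 _.
(* q_k M - p_k N = N rho_k - N q_k (e^(s/t) - M/N), and N |rho_k| is below half of D_k by maximality
   of m. *)
have key : (padeden s k)%:R < 2 * N%:~R * `|pade (- s%:~R) t%:~R k| * Lam :> R.
  have : `|(pade (- s) t k * M - pade s t k * N)%:~R| <=
     N%:~R * `|pade (- s%:~R) t%:~R k| * Lam + N%:~R * `|pade_form s%:~R t%:~R k| :> R.
    rewrite rmorphB !rmorphM /= !pade_rmorph rmorphN /=.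
    rewrite [X in `|X|](_ : _ = N%:~R * pade_form s%:~R t%:~R k -
      N%:~R * pade (- s%:~R) t%:~R k * (expR (s%:~R / t%:~R) - M%:~R / N%:~R)).
      by rewrite (le_trans (ler_normB _ _))// !normrM (gtr0_norm N0) addrC.
    by rewrite /pade_form; field; rewrite lt0r_neq0.
  move=> h; have := le_trans kD h; lra.
set ZF := Zfun R s t N in zb *.
(* Writing N as exp(L), L > 0 cancels in the exponent, and N^(2 log(r) w/(sigma L)) becomes
   r^(2w/sigma) with r = |s|/alpha. *)
have -> : N%:~R `^ (2 + 2 * ln (`|s%:~R| / alpha R s) * w / (sg * L)) =
    N%:~R ^+ 2 * (`|s%:~R| / alpha R s) `^ (2 * (zeta R s t N - (beta s)%:R)) :> R.
  rewrite powRD; last by rewrite (lt0r_neq0 N0) implybT.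
  rewrite powR_mulrn ?(ltW N0)//; congr (_ * _).
  have r0 : 0 < `|s%:~R| / alpha R s :> R by rewrite divr_gt0 ?normr_gt0 ?alpha_gt0.
  rewrite /powR (gt_eqF N0) (gt_eqF r0); congr expR.
  rewrite zE addrK -/L /y.
  have L1 : 0 < L.
    have e1 : 1 < expR 1 :> R by rewrite expR_gt1.
    have l0 : 0 < ln w by rewrite ln_gt0//; lra.
    have y0 : 0 < y by rewrite /y divr_gt0.
    by rewrite LE yE mulr_gt0.
  by field; rewrite !lt0r_neq0.
rewrite -(ltr_pM2l (D0 k)) mulr1 (lt_le_trans key)//.
apply: (le_trans (ler_wpM2r L0 zb)).
by rewrite le_eqVlt; apply/orP; left; apply/eqP; ring.
Qed.
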